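(* Let $m\ge2$, $n\ge1$, $k\ge1$ an integer, and $\mathcal{A}=(a_{i_1i_2\cdots i_m})\in\mathbb{R}_+^{[m,n]}$ with $r_i(\mathcal{A})\neq0$ for all $i\in[n]$. Then \[\min_{i\in[n]}\frac{r_i(\mathcal{A}^{k+1})}{(r_i(\mathcal{A}^k))^{m-1}}\le\rho(\mathcal{A})\le\max_{i\in[n]}\frac{r_i(\mathcal{A}^{k+1})}{(r_i(\mathcal{A}^k))^{m-1}}.\]
   Context: $[n]=\{1,\ldots,n\}$. $\mathbb{R}_+^{[m,n]}$ denotes the set of order $m$, dimension $n$ tensors $\mathcal{A}=(a_{i_1\cdots i_m})$, $i_j\in[n]$, with nonnegative real entries. For a tensor $\mathcal{T}=(t_{i_1\cdots i_p})$ of order $p$ and dimension $n$, $r_i(\mathcal{T})=\sum_{i_2,\ldots,i_p=1}^n|t_{ii_2\cdots i_p}|$. General product: for $\mathcal{A}$ of order $m\ge2$ and $\mathcal{B}$ of order $q\ge1$ (dimension $n$), $\mathcal{A}\mathcal{B}=(c_{i\alpha_1\cdots\alpha_{m-1}})$ is the order $(m-1)(q-1)+1$, dimension $n$ tensor with $c_{i\alpha_1\cdots\alpha_{m-1}}=\sum_{i_2,\ldots,i_m=1}^n a_{ii_2\cdots i_m}b_{i_2\alpha_1}\cdots b_{i_m\alpha_{m-1}}$, $i\in[n]$, $\alpha_j\in[n]^{q-1}$ (where $b_{j\alpha}$ with $\alpha=(j_2,\ldots,j_q)$ means $b_{jj_2\cdots j_q}$). Powers: $\mathcal{A}^1=\mathcal{A}$,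 $\mathcal{A}^{j+1}=\mathcal{A}\mathcal{A}^j$. Eigenvalues: $\lambda\in\mathbb{C}$ is an eigenvalue of $\mathcal{A}$ if there is a nonzero $x\in\mathbb{C}^n$ with $\sum_{i_2,\ldots,i_m=1}^n a_{ii_2\cdots i_m}x_{i_2}\cdots x_{i_m}=\lambda x_i^{m-1}$ for all $i\in[n]$; $\rho(\mathcal{A})$ is the maximum modulus of the eigenvalues of $\mathcal{A}$. *)

(* Defs.v *)
From HB Require Import structures.
From mathcomp Require Import all_boot all_order all_algebra.
From mathcomp Require Import complex.
Set Implicit Arguments. Unset Strict Implicit. Unset Printing Implicit Defensive.
Import Order.TTheory GRing.Theory Num.Theory.
Local Open Scope ring_scope.
Local Open Scope complex_scope.

(* A tensor of order q+1 and dimension n with entries in T: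
   t i alpha = t_{i alpha}, where the first index i ranges over [n]
   and alpha = (i_2, ..., i_{q+1}) is a q-tuple of indices in [n]
   (represented as a finite function 'I_q -> 'I_n).
   NB: the parameter q is the ORDER MINUS ONE. *)
Definition tensor (T : Type) (n q : nat) := 'I_n -> {ffun 'I_q -> 'I_n} -> T.

Definition nonneg_tensor (R : numDomainType) n q (A : tensor R n q) :=
  forall i alpha, 0 <= A i alpha.

Definition rowsum (R : numDomainType) n q (A : tensor R n q) (i : 'I_n) : R :=
  \sum_(alpha : {ffun 'I_q -> 'I_n}) `|A i alpha|.

Lemma blk_lt a b (t : 'I_a) (s : 'I_b) : (t * b + s < a * b)%N.
Proof.
have Ht := ltn_ord t; have Hs := ltn_ord s.
apply: (@leq_trans (t * b + b)%N); first by rewrite ltn_add2l.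
by rewrite -mulSnr leq_mul2r Ht orbT.
Qed.
Definition blk a b (t : 'I_a) (s : 'I_b) : 'I_(a * b)%N := Ordinal (blk_lt t s).

(* General product: A of order a+1, B of order b+1 gives AB of order a*b+1:
   c_{i alpha_1 ... alpha_a} = sum_{i_2..i_{a+1}} a_{i i_2 .. i_{a+1}}
                                 b_{i_2 alpha_1} ... b_{i_{a+1} alpha_a},
   where the tail of length a*b is split into consecutive blocks alpha_t
   of length b. *)
Definition tprod (R : pzSemiRingType) n a b (A : tensor R n a) (B : tensor R n b)
  : tensor R n (a * b)%N :=
  fun i al => \sum_(j : {ffun 'I_a -> 'I_n})
     A i j * \prod_(t < a) B (j t) [ffun s : 'I_b => al (blk t s)].

Fixpoint pow_len (a k : nat) : nat :=
  match k with 0 => a | k'.+1 => (a * pow_len a k')%N end.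

(* tpowS A k = A^{k+1}  (A^1 = A, A^{j+1} = A A^j) *)
Fixpoint tpowS (R : pzSemiRingType) n a (A : tensor R n a) (k : nat)
  : tensor R n (pow_len a k) :=
  match k return tensor R n (pow_len a k) with
  | 0 => A
  | k'.+1 => tprod A (@tpowS R n a A k')
  end.
Arguments tpowS {R n a} A k.

Definition eigenvalue (R : rcfType) n (m : nat) (A : tensor R n m.-1)
  (lambda : R[i]) : Prop :=
  exists x : 'I_n -> R[i], (exists i, x i != 0) /\
    forall i : 'I_n,
      \sum_(j : {ffun 'I_(m.-1) -> 'I_n}) ((A i j)%:C)%C * \prod_(t < m.-1) x (j t)
      = lambda * x i ^+ m.-1.

Definition is_spectral_radius (R : rcfType) n (m : nat) (A : tensor R n m.-1)
  (r : R) : Prop :=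
  (exists lambda, eigenvalue A lambda /\ ComplexField.Normc.normc lambda = r) /\
  (forall lambda, eigenvalue A lambda -> ComplexField.Normc.normc lambda <= r).

(* Main.v *)
Require Import Defs.
From HB Require Import structures.
From mathcomp Require Import all_boot all_order all_algebra.
From mathcomp Require Import complex polyrcf lra.
From mathcomp Require ordered_qelim qe_rcf.
From Stdlib Require Import Classical_Prop.
Import Order.TTheory GRing.Theory Num.Theory.
Local Open Scope ring_scope.
Import ordered_qelim.
Set Implicit Arguments. Unset Strict Implicit. Unset Printing Implicit Defensive.

(* Write A x for the vector of the sums over (i_2, ..., i_m) of
   a_{i i_2 ... i_m} x_{i_2} ... x_{i_m}. The row sums satisfy
   r(A^{k+1}) = A r(A^k), so with the positive vector x = r(A^k) the claim is the
   Collatz-Wielandt inequality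
     min (A x)_i / x_i^{m-1} <= rho(A) <= max (A x)_i / x_i^{m-1}.
   The upper bound compares the moduli of an eigenvector with x at an index where
   their quotient is maximal. The lower bound needs a nonnegative eigenvector
   whose eigenvalue l is at least mu = min (A x)_i / x_i^{m-1}. If A is positive,
   maximize l subject to A y >= l y^{m-1} over the simplex: at a maximum equality
   holds, since raising one coordinate of y with a strict inequality would make
   all of them strict. In general, perturb A to A + s and let s tend to 0.
   Both steps use compactness over an arbitrary real closed field, which holds
   for definable families: by quantifier elimination a definable subset of the
   line is a finite union of intervals, hence has a supremum, and cluster points
   of definable families are built one coordinate at a time. *)

(** * Suprema of definable sets *)

Section Definable.
Variable R : rcfType.
Implicit Types (P Q : seq R -> Prop) (e : seq R).

(** [rs] lists breakpoints. Only segments that avoid them, endpoints included, are compared, so the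
    value of [P] at a breakpoint is unconstrained. *)
Definition piecewise_constant (P : R -> bool) (rs : seq R) :=
  forall a b : R, a < b -> (forall r : R, r \in rs -> ~~ (a <= r <= b)) -> P a = P b.

(** The breakpoints are the roots of [p]: by the intermediate value theorem its sign cannot change
    on a segment without roots. *)
Lemma piecewise_constant_sign (rel : R -> bool) (p : {poly R}) :
  (forall x y, Num.sg x = Num.sg y -> rel x = rel y) ->
  exists rs, piecewise_constant (fun a => rel p.[a]) rs.
Proof.
move=> relP; have [->|p0] := eqVneq p 0.
  by exists [::] => a b _ _; rewrite !horner0.
exists (rootsR p) => a b ab nor; apply: relP.
have nr r : a <= r <= b -> ~~ root p r.
  move=> abr; apply/negP => rp; move: (nor r); rewrite abr.
  by rewrite -(roots_on_rootsR p0) rp andbT => /(_ isT).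
have [pab|pab] := leP (p.[a] * p.[b]) 0.
  have [r rab rp] := polyrcf.poly_ivt (ltW ab) pab.
  by move: rab; rewrite in_itv => /nr; rewrite rp.
have a0 : p.[a] != 0 by apply: nr; rewrite lexx ltW.
have [h|h|h] := ltgtP p.[a] 0; last by rewrite h eqxx in a0.
  by move: pab; rewrite nmulr_rgt0 // => h'; rewrite !ltr0_sg.
by move: pab; rewrite pmulr_rgt0 // => h'; rewrite !gtr0_sg.
Qed.

(** With all variables but the [i]-th frozen, a term is a univariate polynomial, so each atom tests
    the sign of a polynomial. Binary connectives concatenate the lists of breakpoints. *)
Lemma piecewise_constant_qf (f : ord.formula R) e i :
  ord.qf_form f -> ord.rformula f ->
  exists rs, piecewise_constant (fun a => ord.qf_eval (set_nth 0 e i a) f) rs.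
Proof.
have polyE (t : GRing.term R) : GRing.rterm t ->
    exists p : {poly R}, forall a, GRing.eval (set_nth 0 e i a) t = p.[a].
  move=> rt; exists (qe_rcf.eval_poly e (qe_rcf.abstrX i (qe_rcf.to_rterm t))).
  by move=> a; rewrite qe_rcf.abstrXP qe_rcf.evalE qe_rcf.to_rtermE.
have atom (rel : R -> bool) (t1 t2 : GRing.term R) :
    (forall x y, Num.sg x = Num.sg y -> rel x = rel y) ->
    GRing.rterm t1 && GRing.rterm t2 -> exists rs, piecewise_constant
      (fun a => rel (GRing.eval (set_nth 0 e i a) t1 -
                     GRing.eval (set_nth 0 e i a) t2)) rs.
  move=> relP /andP[/polyE[p pE] /polyE[q qE]].
  have [rs rsP] := piecewise_constant_sign (p - q) relP.
  exists rs => a b ab nr; rewrite !pE !qE -!hornerN -!hornerD; exact: rsP.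
elim: f => //=.
- by move=> b _ _; exists [::].
- move=> t1 t2 _ rt; have [|rs rsP] := atom (fun x => x == 0) t1 t2 _ rt.
    by move=> x y xy; rewrite -sgr_eq0 xy sgr_eq0.
  by exists rs => a b ab nr; rewrite -!(subr_eq0 (GRing.eval _ _)); exact: rsP.
- move=> t1 t2 _ rt; have [|rs rsP] := atom (fun x => x < 0) t1 t2 _ rt.
    by move=> x y xy; rewrite -sgr_lt0 xy sgr_lt0.
  by exists rs => a b ab nr; rewrite -!(subr_lt0 (GRing.eval _ _)); exact: rsP.
- move=> t1 t2 _ rt; have [|rs rsP] := atom (fun x => x <= 0) t1 t2 _ rt.
    by move=> x y xy; rewrite -sgr_le0 xy sgr_le0.
  by exists rs => a b ab nr; rewrite -!(subr_le0 (GRing.eval _ _)); exact: rsP.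
1-3: move=> f IHf g IHg /andP[qf qg] /andP[rf rg];
  have [rs rsP] := IHf qf rf; have [rs' rsP'] := IHg qg rg;
  exists (rs ++ rs') => a b ab nr;
  rewrite (rsP a b) ?(rsP' a b) // => r rr; apply: nr;
  by rewrite mem_cat rr ?orbT.
by move=> f IHf qf rf; have [rs rsP] := IHf qf rf;
  exists rs => a b ab nr; rewrite (rsP a b).
Qed.

Definition is_lub (P : R -> Prop) (s : R) :=
  (forall a, P a -> a <= s) /\ forall v : R, v < s -> exists2 a : R, v < a & P a.

Lemma piecewise_constant_lub (P : R -> bool) rs M a0 :
  piecewise_constant P rs -> P a0 -> (forall a, P a -> a <= M) ->
  exists s, is_lub P s.
Proof.
move=> Ppc Pa0 ubM.
(* If no point of [P] lies beyond [a0], then [a0] is a maximum. *)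
have [[a1 a01 Pa1]|noa] := classic (exists2 a, a0 < a & P a); last first.
  exists a0; split=> [a Pa|v va0]; last by exists a0.
  by rewrite leNgt; apply/negP => a0a; apply: noa; exists a.
have {}Ppc : forall a b, a0 < a -> a < b -> b < M ->
    (forall r, r \in rs -> ~~ (a <= r <= b)) -> P a = P b.
  by move=> a b _ ab _; exact: Ppc.
have {a1 a01 Pa1 Pa0}: exists2 a, a0 < a & P a by exists a1.
(* Invariant: [u] is an upper bound of [P] and [l] is not; each breakpoint
   replaces one of them. *)
elim: rs a0 M ubM Ppc => [|r rs IH] l u ubu Ppc [a la Pa].
  (* With no breakpoint left, [P] is constant strictly between [l] and [u] and holds at [a], so
     points of [P] come arbitrarily close to [u]. *)
  exists u; split=> // v vu.
  have [au|au] := eqVneq a u; first by exists a; first by rewrite au.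
  have {}au : a < u by rewrite lt_neqAle au ubu.
  have [va|av] := ltP v a; first by exists a.
  have /andP[vm mu] : v < (v + u) / 2 < u by rewrite !midf_lt.
  exists ((v + u) / 2) => //.
  by rewrite -(Ppc a) //; exact: le_lt_trans av _.
have skip : (forall a b, l < a -> a < b -> b < u -> ~~ (a <= r <= b)) ->
    exists s, is_lub P s.
  move=> out; apply: (IH l u) => //; last by exists a.
  move=> b c lb bc cu nr; apply: Ppc => // r'; rewrite inE => /predU1P[->|].
    exact: out.
  exact: nr.
have [rl|lr] := leP r l.
  apply: skip => b c lb bc cu; apply/nandP; left.
  by rewrite -ltNge (le_lt_trans rl).
have [ur|ru] := leP u r.
  apply: skip => b c lb bc cu; apply/nandP; right.
  by rewrite -ltNge (lt_le_trans cu).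
have [[b rb Pb]|nor] := classic (exists2 b, r < b & P b).
  apply: (IH r u) => //; last by exists b.
  move=> c d rc cd du nr; apply: Ppc => //; first exact: lt_trans lr rc.
  move=> r'; rewrite inE => /predU1P[->|]; last exact: nr.
  by apply/nandP; left; rewrite -ltNge.
apply: (IH l r) => //; last by exists a.
  by move=> b Pb; rewrite leNgt; apply/negP => rb; apply: nor; exists b.
move=> c d lc cd dr nr; apply: Ppc => //; first exact: lt_trans dr ru.
move=> r'; rewrite inE => /predU1P[->|]; last exact: nr.
by apply/nandP; right; rewrite -ltNge.
Qed.

(** [e] assigns values to the variables, missing entries being 0. Terms may contain elements of [R],
    so this is definability with parameters. *)
Definition definable P :=
  exists f : ord.formula R, forall e, ord.holds e f <-> P e.

(** Quantifier elimination replaces the formula by a quantifier-free one, whose section along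
    coordinate [i] is piecewise constant. *)
Lemma definable_lub P i e (M a0 : R) :
  definable P -> P (set_nth 0 e i a0) ->
  (forall a, P (set_nth 0 e i a) -> a <= M) ->
  exists s, is_lub (fun a => P (set_nth 0 e i a)) s.
Proof.
move=> [f fP] Pa0 ubM.
pose w j bc : ord.formula R :=
  qe_rcf.qfr_to_formula (@qe_rcf.wproj R j bc).
pose g := ord.quantifier_elim w (ord.to_rform f).
have gP e' : reflect (P e') (ord.qf_eval e' g).
  by apply: (iffP (qe_rcf.rcf_satP e' f)) => /fP.
have /andP[qg rg] := @ord.quantifier_elim_wf _ w (@qe_rcf.wf_QE_wproj R)
  _ (ord.to_rform_rformula f).
have [rs rsP] := piecewise_constant_qf e i qg rg.
have [] := piecewise_constant_lub rsP (a0 := a0) (M := M); first exact/gP.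
  by move=> a /gP; exact: ubM.
move=> s [ubs lubs]; exists s; split=> [a /gP|v /lubs[a va /gP]]; first exact: ubs.
by exists a.
Qed.

Lemma definable_ext P Q :
  definable P -> (forall e, P e <-> Q e) -> definable Q.
Proof. by move=> [f fP] PQ; exists f => e; rewrite fP. Qed.

Lemma definable_le (t u : GRing.term R) :
  definable (fun e => GRing.eval e t <= GRing.eval e u).
Proof. by exists (ord.Le t u). Qed.

Lemma definable_lt (t u : GRing.term R) :
  definable (fun e => GRing.eval e t < GRing.eval e u).
Proof. by exists (ord.Lt t u). Qed.

Lemma definable_and P Q :
  definable P -> definable Q -> definable (fun e => P e /\ Q e).
Proof. by move=> [f fP] [g gP]; exists (ord.And f g) => e /=; rewrite fP gP. Qed.

Lemma definable_imp P Q :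
  definable P -> definable Q -> definable (fun e => P e -> Q e).
Proof. by move=> [f fP] [g gP]; exists (ord.Implies f g) => e /=; rewrite fP gP. Qed.

Lemma definable_all_fin (I : finType) (P : I -> seq R -> Prop) :
  (forall i, definable (P i)) -> definable (fun e => forall i, P i e).
Proof.
move=> Pd; suff H (s : seq I) : definable (fun e => forall i, i \in s -> P i e).
  apply: (definable_ext (H (enum I))) => e.
  by split=> h i *; apply: h; rewrite ?mem_enum.
elim: s => [|i s IH]; first by exists (ord.Bool true).
apply: (definable_ext (definable_and (Pd i) IH)) => e; split.
  by move=> [Pi Ps] j; rewrite inE => /predU1P[->|/Ps].
by move=> h; split=> [|j js]; apply: h; rewrite inE ?eqxx ?js ?orbT.
Qed.

Lemma definable_exists i P :
  definable P -> definable (fun e => exists x, P (set_nth 0 e i x)).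
Proof.
move=> [f fP]; exists (ord.Exists i f) => e /=.
by split=> [] [x Px]; exists x; apply/fP.
Qed.

Lemma definable_forall i P :
  definable P -> definable (fun e => forall x, P (set_nth 0 e i x)).
Proof.
by move=> [f fP]; exists (ord.Forall i f) => e /=; split=> h x; apply/fP.
Qed.

Definition agree_from N (e e' : seq R) := forall j, (N <= j)%N -> e'`_j = e`_j.

(** The first [N] variables are quantified universally, one at a time. *)
Lemma definable_forall_block N P :
  definable P ->
  definable (fun e => forall e', agree_from N e e' -> P e').
Proof.
(* Truth depends only on entries read with default 0, so lists that differ by trailing zeros are
   interchangeable. *)
move=> Pd; have resp e e' : GRing.same_env e e' -> P e -> P e'.
  by case: Pd => f fP ee' /fP Pe; apply/fP; apply: ord.eq_holds Pe.
elim: N => [|N IH].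
  apply: (definable_ext Pd) => e; split=> [Pe e' ee'|]; last by apply.
  by apply: resp Pe => j; rewrite ee'.
apply: (definable_ext (definable_forall N IH)) => e; split.
  move=> h e' ee'; apply: (h e'`_N e') => j; rewrite leq_eqVlt nth_set_nth /=.
  by case/predU1P=> [->|Nj]; rewrite ?eqxx // gtn_eqF // ee'.
move=> h x e' ee'; apply: h => j Nj; rewrite ee' 1?ltnW // nth_set_nth /=.
by rewrite gtn_eqF.
Qed.

End Definable.

(** * Compactness for polynomial systems *)

Section Compactness.
Variable R : rcfType.
Implicit Types (P : seq R -> Prop) (e x : seq R) (F : R -> seq R -> Prop).

Definition depends_on_first N P :=
  forall e e', (forall j : 'I_N, e'`_j = e`_j) -> P e -> P e'.

Lemma nth_set_nthE e i a j : (set_nth 0 e i a)`_j = if j == i then a else e`_j.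
Proof. by rewrite nth_set_nth. Qed.

Lemma definable_between (t u v : GRing.term R) :
  definable (fun e => GRing.eval e t <= GRing.eval e u <= GRing.eval e v).
Proof.
apply: (definable_ext (definable_and (definable_le t u) (definable_le u v))) => e.
by split=> [[-> ->]|/andP].
Qed.

(* In the definability clause the parameter is read off coordinate [N]. *)
Definition shrinking_family N F :=
  [/\ definable (fun e => F e`_N e), (forall t, depends_on_first N (F t)),
      (forall (s t : R) e, 0 < s <= t -> F s e -> F t e)
    & forall t : R, 0 < t -> exists e, F t e].

(* The coordinate is the supremum of the eventual lower bounds of [e`_k]. *)
Lemma shrinking_family_coord N (k : 'I_N) (B : R) F :
  shrinking_family N F -> (forall t e, F t e -> 0 <= e`_k <= B) ->
  exists s, shrinking_family N (fun t e => F t e /\ s - t <= e`_k <= s + t).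
Proof.
move=> [Fdef Floc Fmono Fne] Fbox.
(* [D] is the set of eventual lower bounds. [Q] expresses it by a formula: position [N] holds the
   parameter t, position [N.+1] the candidate bound. *)
pose D a := exists2 t : R, 0 < t & forall e, F t e -> a <= e`_k.
pose Q e := exists t, 0 < (set_nth 0 e N t)`_N /\
  forall e', agree_from N (set_nth 0 e N t) e' -> F e'`_N e' -> e'`_N.+1 <= e'`_k.
have Qdef : definable Q.
  pose X j : GRing.term R := GRing.Var R j.
  apply: (definable_exists N (P := fun e => 0 < e`_N /\ forall e',
    agree_from N e e' -> F e'`_N e' -> e'`_N.+1 <= e'`_k)).
  apply: (definable_and (definable_lt (GRing.Const 0) (X N))).
  apply: definable_forall_block; apply: definable_imp => //.
  exact: (definable_le (X N.+1) (X k)).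
have QD a : Q (set_nth 0 [::] N.+1 a) <-> D a.
  have eN t : (set_nth 0 (set_nth 0 [::] N.+1 a) N t)`_N = t.
    by rewrite nth_set_nthE eqxx.
  have eN1 t : (set_nth 0 (set_nth 0 [::] N.+1 a) N t)`_N.+1 = a.
    by rewrite nth_set_nthE gtn_eqF // nth_set_nthE eqxx.
  split=> [[t []]|[t t0 Ht]].
    rewrite eN => t0 Ht; exists t => // e Fe.
    (* The positions [N] and [N.+1], which [F] does not read, are filled with [t] and [a]. *)
    pose e' := mkseq (fun j => if (j < N)%N then e`_j else
                               if j == N then t else a) N.+2.
    have e'lt (j : 'I_N) : e'`_j = e`_j.
      by rewrite nth_mkseq /= ?ltn_ord // 2?leqW.
    have e'N : e'`_N = t by rewrite nth_mkseq ?ltnn ?eqxx.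
    have e'N1 : e'`_N.+1 = a by rewrite nth_mkseq // ltnNge leqnSn /= gtn_eqF.
    rewrite -e'lt -[X in X <= _]e'N1; apply: Ht; last first.
      by rewrite e'N; apply: Floc Fe.
    move=> j; rewrite leq_eqVlt => /predU1P[<-|]; first by rewrite eN.
    rewrite leq_eqVlt => /predU1P[<-|Nj]; first by rewrite eN1.
    rewrite nth_default ?size_mkseq // nth_set_nthE gtn_eqF 1?ltnW //.
    by rewrite nth_set_nthE gtn_eqF // nth_nil.
  exists t; rewrite eN; split=> // e' ee'.
  by rewrite (ee' N) // (ee' N.+1) // eN eN1; exact: Ht.
have [s [ubs lubs]] : exists s, is_lub D s.
  have [] := definable_lub (i := N.+1) (e := [::]) (M := B) (a0 := 0) Qdef.
  - by apply/QD; exists 1 => // e /Fbox/andP[].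
  - move=> a /QD[t t0 Ht]; have [e Fe] := Fne t t0.
    by apply: le_trans (Ht e Fe) _; have /andP[] := Fbox _ _ Fe.
  move=> s [ubs lubs]; exists s; split=> [a /QD|v /lubs[a va /QD]]; first exact: ubs.
  by exists a.
exists s; split.
- apply: (definable_and Fdef).
  pose X j : GRing.term R := GRing.Var R j.
  exact: (definable_between (GRing.Add (GRing.Const s) (GRing.Opp (X N)))
    (X k) (GRing.Add (GRing.Const s) (X N))).
- by move=> t e e' ee' [Fe sk]; split; [exact: Floc Fe | rewrite ee'].
- move=> u t e ut [Fe /andP[h1 h2]]; split; first exact: Fmono Fe.
  have /andP[_ {}ut] := ut.
  by rewrite (le_trans _ h1) ?(le_trans h2) ?lerD2l ?lerN2.
- move=> t t0; have [|a sa [t1 t10 Ha]] := lubs (s - t).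
    by rewrite ltrBlDr ltrDl.
  pose u := Num.min t t1; have u0 : 0 < u by rewrite lt_min t0.
  (* [s + t] exceeds the supremum, so it is not an eventual lower bound, and some point of [F u] has
     its coordinate at most [s + t]. *)
  have [e Fe es] : exists2 e, F u e & e`_k <= s + t.
    apply: NNPP => no; have : D (s + t).
      exists u => // e Fe; rewrite leNgt; apply/negP => h; apply: no.
      by exists e => //; exact: ltW.
    by move=> /ubs; rewrite gerDl leNgt t0.
  exists e; split; first by apply: Fmono Fe; rewrite u0 ge_min lexx.
  rewrite es andbT (le_trans (ltW sa)) //; apply: Ha; apply: Fmono Fe.
  by rewrite u0 ge_min lexx orbT.
Qed.

Definition box N (B : R) e := forall j : 'I_N, 0 <= e`_j <= B.

(** Coordinates are pinned one at a time: at stage [k] the first [k] are within t of their limits,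
    and the refined family is still shrinking. *)
Lemma shrinking_family_cluster N (B : R) F :
  shrinking_family N F -> (forall t e, F t e -> box N B e) ->
  exists x, forall t : R, 0 < t -> exists2 e, F t e &
    forall j : 'I_N, `|e`_j - x`_j| <= t.
Proof.
move=> Fsh Fbox.
suff H k : (k <= N)%N -> exists x, shrinking_family N
    (fun t e => F t e /\ forall j : 'I_N, (j < k)%N -> `|e`_j - x`_j| <= t).
  have [x [_ _ _ xne]] := H N (leqnn N); exists x => t /xne[e [Fe ex]].
  by exists e => // j; exact: ex.
elim: k => [_|k IH kN].
  exists [::]; case: Fsh => Fdef Floc Fmono Fne; split.
  - by apply: (definable_ext Fdef) => e; split=> // -[].
  - by move=> t e e' ee' [Fe _]; split=> //; exact: Floc Fe.
  - by move=> s t e st [Fe _]; split=> //; exact: Fmono Fe.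
  - by move=> t /Fne[e Fe]; exists e.
have [x xsh] := IH (ltnW kN).
have [|s [sdef sloc smono sne]] :=
  @shrinking_family_coord N (Ordinal kN) B _ xsh.
  by move=> t e [/Fbox/(_ (Ordinal kN))].
pose y := set_nth 0 x k s; exists y.
have yP t e : ((F t e /\ forall j : 'I_N, (j < k)%N -> `|e`_j - x`_j| <= t) /\
     s - t <= e`_k <= s + t) <->
    (F t e /\ forall j : 'I_N, (j < k.+1)%N -> `|e`_j - y`_j| <= t).
  rewrite -ler_distl; split=> [[[Fe ex] es]|[Fe ey]].
    split=> // j; rewrite ltnS leq_eqVlt nth_set_nthE.
    by case/predU1P=> [->|jk]; rewrite ?eqxx // ltn_eqF // ex.
  split; [split=> // j jk|].
    by have := ey j (ltnW jk); rewrite nth_set_nthE ltn_eqF.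
  by have := ey (Ordinal kN) (ltnSn k); rewrite nth_set_nthE eqxx.
split.
- by apply: (definable_ext sdef) => e; exact: yP.
- by move=> t e e' ee' /yP h; apply/yP; exact: sloc h.
- by move=> u t e ut /yP h; apply/yP; exact: smono h.
- by move=> t /sne[e /yP h]; exists e.
Qed.

(** * Polynomial functions: continuity, compactness and attained maxima *)

Inductive polyfun N : (seq R -> R) -> Prop :=
| polyfun_const c : polyfun N (fun _ => c)
| polyfun_coord (j : 'I_N) : polyfun N (fun e => e`_j)
| polyfun_add p q : polyfun N p -> polyfun N q -> polyfun N (fun e => p e + q e)
| polyfun_mul p q : polyfun N p -> polyfun N q -> polyfun N (fun e => p e * q e)
| polyfun_ext p q : polyfun N p -> p =1 q -> polyfun N q.

Lemma polyfun_opp N p : polyfun N p -> polyfun N (fun e => - p e).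
Proof.
move=> pp; apply: polyfun_ext (polyfun_mul (polyfun_const N (-1)) pp) _ => e.
by rewrite mulN1r.
Qed.

Lemma polyfun_sub N p q :
  polyfun N p -> polyfun N q -> polyfun N (fun e => p e - q e).
Proof. by move=> pp qp; exact/polyfun_add/polyfun_opp. Qed.

Lemma polyfun_sum N (I : finType) (p : I -> seq R -> R) :
  (forall i, polyfun N (p i)) -> polyfun N (fun e => \sum_i p i e).
Proof.
move=> pp; elim: (index_enum I) => [|i r IH].
  by apply: polyfun_ext (polyfun_const N 0) _ => e; rewrite big_nil.
by apply: polyfun_ext (polyfun_add (pp i) IH) _ => e; rewrite big_cons.
Qed.

Lemma polyfun_prod N (I : finType) (p : I -> seq R -> R) :
  (forall i, polyfun N (p i)) -> polyfun N (fun e => \prod_i p i e).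
Proof.
move=> pp; elim: (index_enum I) => [|i r IH].
  by apply: polyfun_ext (polyfun_const N 1) _ => e; rewrite big_nil.
by apply: polyfun_ext (polyfun_mul (pp i) IH) _ => e; rewrite big_cons.
Qed.

Lemma polyfun_exp N p d : polyfun N p -> polyfun N (fun e => p e ^+ d).
Proof.
move=> pp; elim: d => [|d IH]; first exact: polyfun_const.
by apply: polyfun_ext (polyfun_mul pp IH) _ => e; rewrite exprS.
Qed.

Lemma polyfun_term N p : polyfun N p ->
  exists t : GRing.term R, forall e, GRing.eval e t = p e.
Proof.
elim=> [c|j|{}p q _ [t tP] _ [u uP]|{}p q _ [t tP] _ [u uP]|{}p q _ [t tP] pq].
- by exists (GRing.Const c).
- by exists (GRing.Var R j).
- by exists (GRing.Add t u) => e /=; rewrite tP uP.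
- by exists (GRing.Mul t u) => e /=; rewrite tP uP.
- by exists t => e; rewrite tP pq.
Qed.

Lemma polyfun_local N p e e' : polyfun N p ->
  (forall j : 'I_N, e'`_j = e`_j) -> p e' = p e.
Proof.
move=> pp ee'; elim: pp => // [{}p q _ -> _ ->|{}p q _ -> _ ->|{}p q _ pe pq] //.
by rewrite -!pq.
Qed.

Lemma polyfun_continuous N p x : polyfun N p -> forall eps : R, 0 < eps ->
  exists2 d : R, 0 < d & forall e, (forall j : 'I_N, `|e`_j - x`_j| <= d) ->
    `|p e - p x| <= eps.
Proof.
elim=> [c|j|{}p q _ IHp _ IHq|{}p q _ IHp _ IHq|{}p q _ IHp pq] eps eps0.
- by exists 1 => // e _; rewrite subrr normr0 ltW.
- by exists eps.
- have eps20 : 0 < eps / 2 by rewrite divr_gt0.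
  have [d d0 dP] := IHp _ eps20; have [d' d'0 d'P] := IHq _ eps20.
  exists (Num.min d d') => [|e]; first by rewrite lt_min d0.
  move=> h; rewrite opprD addrACA (le_trans (ler_normD _ _)) //.
  rewrite [leRHS](splitr eps) lerD ?dP ?d'P // => j;
  by rewrite (le_trans (h j)) // ge_min lexx ?orbT.
- have q0 : 0 < `|q x| + 1 by rewrite ltr_wpDl.
  have p0 : 0 < `|p x| + 1 by rewrite ltr_wpDl.
  have [|d d0 dP] := IHp (eps / 2 / (`|q x| + 1)); first by rewrite !divr_gt0.
  have [|d' d'0 d'P] := IHq (Num.min 1 (eps / 2 / (`|p x| + 1))).
    by rewrite lt_min ltr01 !divr_gt0.
  exists (Num.min d d') => [|e]; first by rewrite lt_min d0.
  move=> h; have hp : `|p e - p x| <= eps / 2 / (`|q x| + 1).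
    by apply: dP => j; rewrite (le_trans (h j)) // ge_min lexx.
  have : `|q e - q x| <= Num.min 1 (eps / 2 / (`|p x| + 1)).
    by apply: d'P => j; rewrite (le_trans (h j)) // ge_min lexx orbT.
  rewrite le_min => /andP[hq1 hq].
  have qe : `|q e| <= `|q x| + 1.
    by rewrite -[q e](subrK (q x)) addrC (le_trans (ler_normD _ _)) // lerD2l.
  (* The cap 1 on the variation of [q] bounds [q e] by the constant [|q x| + 1], which the tolerance
     chosen for [p] compensates. *)
  have -> : p e * q e - p x * q x = (p e - p x) * q e + p x * (q e - q x).
    by rewrite mulrBl mulrBr addrA subrK.
  rewrite (le_trans (ler_normD _ _)) // [leRHS](splitr eps) !normrM lerD //.
    rewrite -[leRHS](divfK (lt0r_neq0 q0)) ler_pM ?normr_ge0 //.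
  rewrite -[leRHS](divfK (lt0r_neq0 p0)) mulrC ler_pM ?normr_ge0 //.
  by rewrite lerDl.
- by have [d d0 dP] := IHp _ eps0; exists d => // e /dP; rewrite !pq.
Qed.

(** The points solving the system up to an error t form a shrinking family; by continuity a cluster
    point solves it exactly. *)
Lemma polyfun_compact (I : finType) N (B : R) (g : I -> seq R -> R) :
  (forall i, polyfun N (g i)) ->
  (forall t : R, 0 < t -> exists2 e, box N B e & forall i, - t <= g i e) ->
  exists2 x, box N B x & forall i, 0 <= g i x.
Proof.
move=> gp ne; pose F t e := box N B e /\ forall i, - t <= g i e.
have Fsh : shrinking_family N F.
  pose X j : GRing.term R := GRing.Var R j.
  split.
  - apply: definable_and; first apply: definable_all_fin => j.
      exact: (definable_between (GRing.Const 0) (X j) (GRing.Const B)).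
    apply: definable_all_fin => i; have [t tP] := polyfun_term (gp i).
    apply: (definable_ext (definable_le (GRing.Opp (X N)) t)) => e.
    by rewrite tP.
  - move=> t e e' ee' [be ge]; split=> [j|i]; first by rewrite ee'.
    by rewrite (polyfun_local (gp i) ee').
  - move=> s t e /andP[_ st] [be ge]; split=> // i.
    by apply: le_trans (ge i); rewrite lerN2.
  - by move=> t /ne[e be ge]; exists e.
have [|x xP] := shrinking_family_cluster (B := B) Fsh; first by move=> t e [].
have closed p : polyfun N p ->
    (forall t : R, 0 < t -> forall e, F t e -> - t <= p e) -> 0 <= p x.
  move=> pp Fp; rewrite leNgt; apply/negP => px.
  (* With v = p x negative, a nearby point of the family would satisfy both p e >= v/3 and p e <=
     2v/3, which is absurd. *)
  have h0 : 0 < - p x / 3 by rewrite divr_gt0 // oppr_gt0.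
  have [d d0 dP] := polyfun_continuous x pp h0.
  pose t := Num.min d (- p x / 3); have t0 : 0 < t by rewrite lt_min d0.
  have [e Fe ex] := xP t t0.
  have : `|p e - p x| <= - p x / 3.
    by apply: dP => j; rewrite (le_trans (ex j)) // ge_min lexx.
  move=> /(le_trans (ler_norm _)).
  have : - (- p x / 3) <= p e.
    by apply: le_trans (Fp t t0 e Fe); rewrite lerN2 ge_min lexx orbT.
  set u := p e; set v := p x in px *; move=> h1 h2; lra.
exists x => [j|i]; last by apply: closed => // t t0 e [].
have xp := polyfun_coord j.
apply/andP; split.
  apply: (closed _ xp) => t t0 e [/(_ j)/andP[ej _] _].
  by rewrite (le_trans _ ej) // oppr_le0 ltW.
rewrite -subr_ge0; apply: (closed _ (polyfun_sub (polyfun_const N B) xp)).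
move=> t t0 e [/(_ j)/andP[_ ej] _].
by rewrite (@le_trans _ _ 0) ?subr_ge0 // oppr_le0 ltW.
Qed.

(** The supremum [s] of coordinate [k] over the feasible set is attained: the system stays
    approximately solvable once the constraint that coordinate [k] is at least [s] is added. *)
Lemma polyfun_max_coord (I : finType) N (k : 'I_N) (B : R)
    (g : I -> seq R -> R) e0 :
  (forall i, polyfun N (g i)) -> box N B e0 -> (forall i, 0 <= g i e0) ->
  exists2 x, box N B x /\ (forall i, 0 <= g i x) &
    forall e, box N B e -> (forall i, 0 <= g i e) -> e`_k <= x`_k.
Proof.
move=> gp be0 ge0; pose K e := box N B e /\ forall i, 0 <= g i e.
pose X j : GRing.term R := GRing.Var R j.
have Kdef : definable K.
  apply: definable_and; first apply: definable_all_fin => j.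
    exact: (definable_between (GRing.Const 0) (X j) (GRing.Const B)).
  apply: definable_all_fin => i; have [t tP] := polyfun_term (gp i).
  by apply: (definable_ext (definable_le (GRing.Const 0) t)) => e; rewrite tP.
have Kloc : depends_on_first N K.
  move=> e e' ee' [be ge]; split=> [j|i]; first by rewrite ee'.
  by rewrite (polyfun_local (gp i) ee').
pose Q e := forall e', agree_from N e e' -> K e' -> e'`_k <= e'`_N.
have Qdef : definable Q.
  apply: definable_forall_block; apply: definable_imp => //.
  exact: (definable_le (X k) (X N)).
have QP a : Q (set_nth 0 [::] N a) <-> forall e, K e -> e`_k <= a.
  have eN : (set_nth 0 [::] N a)`_N = a by rewrite nth_set_nthE eqxx.
  split=> [Qa e Ke|Ka e' ee' /Ka]; last by rewrite (ee' N) // eN.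
  pose e' := mkseq (fun j => if (j < N)%N then e`_j else a) N.+1.
  have e'lt (j : 'I_N) : e'`_j = e`_j by rewrite nth_mkseq /= ?ltn_ord // ?leqW.
  have e'N : e'`_N = a by rewrite nth_mkseq ?ltnn.
  rewrite -e'lt -[X in _ <= X]e'N; apply: Qa; last exact: Kloc Ke.
  move=> j; rewrite leq_eqVlt => /predU1P[<-|Nj]; first by rewrite eN e'N.
  by rewrite nth_default ?size_mkseq // nth_set_nthE gtn_eqF // nth_nil.
(* [s] is obtained as the supremum of the numbers that are not upper bounds of coordinate [k]. *)
have [s [ubs lubs]] : exists s, is_lub (fun a => ~ Q (set_nth 0 [::] N a)) s.
  have nQdef : definable (fun e => ~ Q e).
    by apply: definable_imp => //; exists (ord.Bool false) => e; split.
  apply: (definable_lub (M := B) (a0 := e0`_k - 1) nQdef).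
    by move=> /QP/(_ e0 (conj be0 ge0)); rewrite lerBrDr gerDl ler10.
  move=> a nQ; rewrite leNgt; apply/negP => Ba; apply: nQ; apply/QP.
  by move=> e [/(_ k)/andP[_ ek] _]; rewrite (le_trans ek) ?ltW.
have [||x bx gx] := @polyfun_compact (option I) N B
    (fun i e => if i is Some i then g i e else e`_k - s).
- by move=> [i|] //; apply: (polyfun_sub (polyfun_coord k) (polyfun_const N s)).
- move=> t t0; have [|a sa nQ] := lubs (s - t); first by rewrite ltrBlDr ltrDl.
  apply: NNPP => no; apply: nQ; apply/QP => e [be ge].
  rewrite leNgt; apply/negP => ae; apply: no; exists e => // -[i|].
    by rewrite (le_trans _ (ge i)) // oppr_le0 ltW.
  by rewrite lerBrDr addrC ltW // (lt_trans sa).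
exists x; first by split=> // i; exact: gx (Some i).
move=> e be ge; apply: le_trans (_ : s <= _); last first.
  by rewrite -subr_ge0; exact: gx None.
(* Otherwise the midpoint of [s] and the larger value would be a non-upper-bound above [s]. *)
rewrite leNgt; apply/negP => se.
have : s < (s + e`_k) / 2 by rewrite midf_lt.
rewrite ltNge => /negP; apply; apply: ubs => /QP/(_ e (conj be ge)).
by rewrite leNgt midf_lt.
Qed.

End Compactness.

(** * Nonnegative eigenvectors *)

Section TensorAction.
Variables (R : rcfType) (n d : nat).
Implicit Types (A : tensor R n d) (x y : 'I_n -> R).

Definition tapply A x (i : 'I_n) : R :=
  \sum_(j : {ffun 'I_d -> 'I_n}) A i j * \prod_(t < d) x (j t).

Lemma tapply_ge0 A x i : nonneg_tensor A -> (forall j, 0 <= x j) ->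
  0 <= tapply A x i.
Proof.
by move=> A0 x0; apply: sumr_ge0 => j _; rewrite mulr_ge0 ?A0 ?prodr_ge0.
Qed.

Lemma ler_tapply A x y i : nonneg_tensor A ->
  (forall j, 0 <= x j <= y j) -> tapply A x i <= tapply A y i.
Proof.
by move=> A0 xy; apply: ler_sum => j _; rewrite ler_wpM2l ?A0 // ler_prod.
Qed.

Lemma tapplyZ A c x i : tapply A (fun j => c * x j) i = c ^+ d * tapply A x i.
Proof.
rewrite /tapply mulr_sumr; apply: eq_bigr => j _.
by rewrite big_split /= prodr_const card_ord mulrCA.
Qed.

(** The sum of all monomials of degree [d] over index tuples factors as a [d]-th power. *)
Lemma tapply_addC A s x i :
  tapply (fun i j => A i j + s) x i = tapply A x i + s * (\sum_j x j) ^+ d.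
Proof.
rewrite /tapply; under eq_bigr do rewrite mulrDl.
rewrite big_split /= -mulr_sumr; congr (_ + _ * _).
by rewrite -(bigA_distr_bigA (fun _ : 'I_d => x)) /= prodr_const card_ord.
Qed.

(** The monomial of the constant tuple [i0] grows strictly and has a positive coefficient; the
    others do not decrease. *)
Lemma ltr_tapply A x y i i0 : (forall i j, 0 < A i j) -> (0 < d)%N ->
  (forall j, 0 <= x j <= y j) -> x i0 < y i0 -> tapply A x i < tapply A y i.
Proof.
move=> A0 d0 xy xy0; rewrite /tapply.
rewrite (bigD1 [ffun=> i0]) //= [ltRHS](bigD1 [ffun=> i0]) //=.
apply: ltr_leD; last first.
  by apply: ler_sum => j _; rewrite ler_wpM2l ?ler_prod // ltW.
rewrite ltr_pM2l //; under eq_bigr do rewrite ffunE.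
under [ltRHS]eq_bigr do rewrite ffunE.
rewrite !prodr_const card_ord ltrXn2r -?lt0n //.
by have /andP[] := xy i0.
Qed.

(* Compare at an index where [y i / x i] is maximal. *)
Lemma collatz_wielandt_le A x y (l M : R) i0 : nonneg_tensor A ->
  (forall i, 0 < x i) -> (forall i, 0 <= y i) -> y i0 != 0 ->
  (forall i, l * y i ^+ d <= tapply A y i) ->
  (forall i, tapply A x i <= M * x i ^+ d) -> l <= M.
Proof.
move=> A0 x0 y0 yi0 ly xM.
case: (@arg_maxP _ _ _ i0 predT (fun i => y i / x i) isT) => i _ imax0.
have imax j : y j / x j <= y i / x i := imax0 j isT.
have yi0_gt0 : 0 < y i0 by rewrite lt_neqAle eq_sym yi0 y0.
pose c := y i / x i.
have c0 : 0 < c by apply: lt_le_trans (imax i0); rewrite divr_gt0.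
have yE : y i = c * x i by rewrite divfK ?gt_eqF.
have yi : 0 < y i ^+ d by rewrite exprn_gt0 // yE mulr_gt0.
rewrite -(ler_pM2r yi); apply: le_trans (ly i) _.
apply: le_trans (_ : tapply A (fun j => c * x j) i <= _).
  by apply: ler_tapply => // j; rewrite y0 -ler_pdivrMr // imax.
by rewrite tapplyZ yE [X in M * X]exprMn mulrCA ler_pM2l ?exprn_gt0.
Qed.

Lemma exists_pos_forall (I : finType) (P : I -> R -> Prop) :
  (forall i, exists2 c : R, 0 < c & forall s, 0 < s <= c -> P i s) ->
  exists2 c : R, 0 < c & forall i, P i c.
Proof.
move=> Pex; suff H (r : seq I) : exists2 c : R, 0 < c &
    forall i, i \in r -> forall s, 0 < s <= c -> P i s.
  have [c c0 cP] := H (enum I); exists c => // i; apply: cP.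
    by rewrite mem_enum.
  by rewrite c0 lexx.
elim: r => [|i r [c c0 cP]]; first by exists 1.
have [c' c'0 c'P] := Pex i; exists (Num.min c c'); first by rewrite lt_min c0.
move=> j jr s /andP[s0]; rewrite le_min => /andP[sc sc'].
move: jr; rewrite inE => /predU1P[->|jr]; first by apply: c'P; rewrite s0.
by apply: cP => //; rewrite s0.
Qed.

(** Coordinate [i] is raised slightly. Row [i] keeps its slack by continuity, positivity of [A]
    makes every other row strict, and the finitely many slacks leave room to raise [l]. *)
Lemma subeigenvector_perturb A x (l : R) i : (forall i j, 0 < A i j) ->
  (0 < d)%N -> (forall j, 0 <= x j) ->
  (forall j, l * x j ^+ d <= tapply A x j) -> l * x i ^+ d < tapply A x i ->
  exists y, [/\ (forall j, 0 <= y j), 0 < y i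
    & exists2 c : R, 0 < c & forall j, (l + c) * y j ^+ d <= tapply A y j].
Proof.
move=> A0 d0 x0 lx lxi.
have Age0 : nonneg_tensor A by move=> *; exact: ltW.
have gap0 : 0 < tapply A x i - l * x i ^+ d by rewrite subr_gt0.
have [e e0 eP] := poly_cont (x i) (l *: 'X^d) gap0.
pose y j := if j == i then x i + e / 2 else x j.
have e20 : 0 < e / 2 by rewrite divr_gt0.
have xy j : 0 <= x j <= y j.
  by rewrite x0 /= /y; case: eqVneq => [->|_] //; rewrite lerDl ltW.
have yi : y i = x i + e / 2 by rewrite /y eqxx.
have strict j : l * y j ^+ d < tapply A y j.
  have [->|ji] := eqVneq j i.
    apply: lt_le_trans (ler_tapply i Age0 xy); rewrite yi.
    have := eP (x i + e / 2); rewrite addrAC subrr add0r gtr0_norm //.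
    rewrite !hornerE => /(_ _)/(le_lt_trans (ler_norm _)).
    by rewrite ltrD2r; apply; rewrite ltr_pdivrMr // mulr_natr mulr2n ltrDl.
  have -> : y j = x j by rewrite /y (negbTE ji).
  apply: le_lt_trans (lx j) _; apply: (@ltr_tapply _ _ _ _ i) => //.
  by rewrite yi ltrDl.
have y0 j : 0 <= y j by have /andP[/le_trans] := xy j; apply.
exists y; split=> //; first by rewrite yi ltr_wpDl.
apply: (@exists_pos_forall _ (fun j c => (l + c) * y j ^+ d <= tapply A y j)) => j.
have yj : 0 < y j ^+ d + 1 by rewrite ltr_wpDl // exprn_ge0.
(* The slack of row [j] divided by its coefficient; the added 1 keeps the denominator positive when
   [y j] is 0. *)
exists ((tapply A y j - l * y j ^+ d) / (y j ^+ d + 1)).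
  by rewrite divr_gt0 // subr_gt0.
move=> s /andP[s0]; rewrite ler_pdivlMr // mulrDl -lerBrDl => sle.
by apply: le_trans sle; rewrite ler_pM2l // lerDl.
Qed.

(** Both sides are homogeneous of degree [d], so [x] can be divided by its sum. *)
Lemma tapply_normalize A x (l : R) : (forall i, 0 <= x i) ->
  (exists i, x i != 0) -> (forall i, l * x i ^+ d <= tapply A x i) ->
  exists y, [/\ (forall i, 0 <= y i), \sum_i y i = 1
    & forall i, l * y i ^+ d <= tapply A y i].
Proof.
move=> x0 [i xi] lx; pose S := \sum_i x i.
have S0 : 0 < S.
  rewrite /S (bigD1 i) //= ltr_wpDr ?sumr_ge0 //.
  by rewrite lt_neqAle eq_sym xi x0.
exists (fun i => S^-1 * x i); split.
- by move=> j; rewrite mulr_ge0 // invr_ge0 ltW.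
- by rewrite -mulr_sumr mulVf ?gt_eqF.
- move=> j; rewrite tapplyZ exprMn mulrCA ler_pM2l //.
  by rewrite exprn_gt0 // invr_gt0.
Qed.

(* A vector and a scalar [l] packed as a point of R^(n+1). *)
Definition env x (l : R) : seq R :=
  mkseq (fun j => if insub j is Some i then x i else l) n.+1.

Lemma nth_env x l (i : 'I_n) : (env x l)`_i = x i.
Proof. by rewrite nth_mkseq ?valK // ltnW // ltnS. Qed.

Lemma nth_env_last x l : (env x l)`_n = l.
Proof. by rewrite nth_mkseq // insubF // ltnn. Qed.

Lemma box_env x (l B : R) : (forall i, 0 <= x i) -> \sum_i x i = 1 -> 1 <= B ->
  0 <= l <= B -> box n.+1 B (env x l).
Proof.
move=> x0 x1 B1 lB j; have [jn|nj] := ltnP j n; last first.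
  have -> : nat_of_ord j = n by apply/eqP; rewrite eqn_leq nj -ltnS ltn_ord.
  by rewrite nth_env_last.
rewrite (nth_env x l (Ordinal jn)) x0 (le_trans _ B1) // -x1.
by rewrite (bigD1 (Ordinal jn)) //= lerDl sumr_ge0.
Qed.

Lemma polyfun_nth (i : 'I_n) : polyfun n.+1 (fun e : seq R => e`_i).
Proof. exact: (polyfun_coord R (widen_ord (leqnSn n) i)). Qed.

Lemma polyfun_sum_nth : polyfun n.+1 (fun e : seq R => \sum_(i < n) e`_i).
Proof. by apply: polyfun_sum => i; exact: polyfun_nth. Qed.

Lemma polyfun_residual A i :
  polyfun n.+1 (fun e => tapply A (fun j => e`_j) i - e`_n * e`_i ^+ d).
Proof.
apply: polyfun_sub.
  apply: polyfun_sum => j; apply: polyfun_mul (polyfun_const _ _) _.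
  by apply: polyfun_prod => t; exact: polyfun_nth.
apply: polyfun_mul (polyfun_coord R (@ord_max n)) _.
exact/polyfun_exp/polyfun_nth.
Qed.

Lemma tapply_env A x l i : tapply A (fun j : 'I_n => (env x l)`_j) i = tapply A x i.
Proof.
by apply: eq_bigr => j _; congr (_ * _); apply: eq_bigr => t _; rewrite nth_env.
Qed.

Lemma sum_env x l : \sum_(j < n) (env x l)`_j = \sum_j x j.
Proof. by apply: eq_bigr => j _; rewrite nth_env. Qed.

Lemma simplex_neq0 x : \sum_i x i = 1 -> exists i, x i != 0.
Proof.
move=> x1; apply/existsP; apply: contra_eqT x1 => /existsPn x0.
rewrite big1 1?eq_sym ?oner_eq0 // => i _; apply/eqP.
by have := x0 i; rewrite negbK.
Qed.

(* For positive tensors an eigenpair is found by maximizing [l] subject to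
   [l x^d <= A x] on the simplex: a strict inequality could be improved. *)
Lemma perron_positive A x (mu B : R) : (0 < d)%N -> (forall i j, 0 < A i j) ->
  1 <= B -> (forall i, tapply A (fun=> 1) i <= B) -> 0 <= mu ->
  (forall i, 0 <= x i) -> (exists i, x i != 0) ->
  (forall i, mu * x i ^+ d <= tapply A x i) ->
  exists y l, [/\ (forall i, 0 <= y i), \sum_i y i = 1, mu <= l <= B
    & forall i, tapply A y i = l * y i ^+ d].
Proof.
move=> d0 A0 B1 AB mu0 x_ge0 x_neq0 mux.
have Age0 : nonneg_tensor A by move=> *; exact: ltW.
(* Comparison with the all-ones vector bounds every admissible [l], which makes the search region a
   box. *)
have bound y l : (forall i, 0 <= y i) -> (exists i, y i != 0) ->
    (forall i, l * y i ^+ d <= tapply A y i) -> l <= B.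
  move=> y0 [i yi] ly.
  apply: (@collatz_wielandt_le A (fun=> 1) y _ _ i) => // j.
  by rewrite expr1n mulr1.
have [z [z0 z1 muz]] := tapply_normalize x_ge0 x_neq0 mux.
(* The simplex equation is encoded as two opposite inequalities. *)
pose g (i : 'I_n + bool) (e : seq R) : R := match i with
  | inl i => tapply A (fun j => e`_j) i - e`_n * e`_i ^+ d
  | inr true => \sum_(j < n) e`_j - 1
  | inr false => 1 - \sum_(j < n) e`_j end.
have gp i : polyfun n.+1 (g i).
  have cp := polyfun_const (R := R) n.+1 1.
  case: i => [i|[]]; first exact: polyfun_residual.
    exact: (polyfun_sub polyfun_sum_nth cp).
  exact: (polyfun_sub cp polyfun_sum_nth).
have genv y l : \sum_i y i = 1 -> (forall i, l * y i ^+ d <= tapply A y i) ->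
    forall i, 0 <= g i (env y l).
  move=> y1 ly [i|[]] /=; rewrite ?sum_env ?y1 ?subrr //.
  by rewrite tapply_env nth_env_last nth_env subr_ge0.
have [||e [be ge] emax] := @polyfun_max_coord _ _ _ (@ord_max n) B _
    (env z mu) gp.
- by apply: box_env => //; rewrite mu0 (bound z) //; exact: simplex_neq0.
- exact: genv.
pose y (i : 'I_n) := e`_i; pose l := e`_n.
have y0 i : 0 <= y i by have /andP[] := be (widen_ord (leqnSn n) i).
have y1 : \sum_i y i = 1.
  apply/le_anti; rewrite -subr_ge0 -[X in _ && X]subr_ge0.
  by rewrite (ge (inr false)) (ge (inr true)).
have ly i : l * y i ^+ d <= tapply A y i by rewrite -subr_ge0; exact: (ge (inl i)).
(* Competitors off the simplex are rescaled onto it. *)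
have lmax y' l' : (forall i, 0 <= y' i) -> (exists i, y' i != 0) -> 0 <= l' ->
    (forall i, l' * y' i ^+ d <= tapply A y' i) -> l' <= l.
  move=> y'0 y'n0 l'0 ly'.
  have [w [w0 w1 lw]] := tapply_normalize y'0 y'n0 ly'.
  have := emax (env w l'); rewrite /= nth_env_last; apply; last exact: genv.
  by apply: box_env => //; rewrite l'0 (bound w) //; exact: simplex_neq0.
have mul : mu <= l by apply: (lmax x).
exists y, l; split=> // [|i].
  by rewrite mul; have := be (@ord_max n); rewrite /= -/l => /andP[].
apply/eqP; rewrite eq_le ly andbT leNgt; apply/negP => lt_i.
have [y' [y'0 y'i [c c0 ly']]] := subeigenvector_perturb A0 d0 y0 ly lt_i.
have : l + c <= l.
  apply: (lmax y') => //; first by exists i; rewrite gt_eqF.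
  by rewrite addr_ge0 ?(ltW c0) // (le_trans mu0).
by rewrite gerDl leNgt c0.
Qed.

(* Positive perturbations [A + s] have eigenpairs, which are approximate
   eigenpairs of [A]; compactness turns these into an exact one. *)
Lemma perron_nonneg A x (mu : R) : (0 < d)%N -> nonneg_tensor A -> 0 <= mu ->
  (forall i, 0 <= x i) -> (exists i, x i != 0) ->
  (forall i, mu * x i ^+ d <= tapply A x i) ->
  exists y l, [/\ (forall i, 0 <= y i), (exists i, y i != 0), mu <= l
    & forall i, tapply A y i = l * y i ^+ d].
Proof.
move=> d0 A0 mu0 x_ge0 x_neq0 mux.
(* [B] bounds the row sums of A + s for all s <= 1 at once, since the perturbation contributes s
   n^d; the final 1 ensures [1 <= B]. *)
pose S := \sum_i tapply A (fun=> 1) i; pose B := S + n%:R ^+ d + 1.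
have nd0 : 0 <= (n%:R : R) ^+ d by rewrite exprn_ge0.
have S0 : 0 <= S by apply: sumr_ge0 => i _; apply: tapply_ge0.
have B1 : 1 <= B by rewrite lerDr addr_ge0.
pose g (i : 'I_n + 'I_n + (bool + unit)) (e : seq R) : R := match i with
  | inl (inl i) => tapply A (fun j => e`_j) i - e`_n * e`_i ^+ d
  | inl (inr i) => - (tapply A (fun j => e`_j) i - e`_n * e`_i ^+ d)
  | inr (inl true) => \sum_(j < n) e`_j - 1
  | inr (inl false) => 1 - \sum_(j < n) e`_j
  | inr (inr _) => e`_n - mu end.
have gp i : polyfun n.+1 (g i).
  have cp c := polyfun_const (R := R) n.+1 c.
  case: i => [[i|i]|[[]|[]]]; first exact: polyfun_residual.
  - exact/polyfun_opp/polyfun_residual.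
  - exact: (polyfun_sub polyfun_sum_nth (cp 1)).
  - exact: (polyfun_sub (cp 1) polyfun_sum_nth).
  - exact: (polyfun_sub (polyfun_coord R (@ord_max n)) (cp mu)).
have [t t0|e be ge] := polyfun_compact (B := B) gp.
  pose s := Num.min t 1; have s0 : 0 < s by rewrite lt_min t0 ltr01.
  have [|||||||y [l [y0 y1 /andP[mul lB] yE]]] :=
    @perron_positive (fun i j => A i j + s) x mu B d0.
  - by move=> i j; rewrite ltr_wpDl.
  - exact: B1.
  - move=> i; rewrite tapply_addC sumr_const card_ord /B.
    rewrite -addrA lerD //.
      by rewrite /S (bigD1 i) //= lerDl sumr_ge0 // => j _; exact: tapply_ge0.
    rewrite (@le_trans _ _ (n%:R ^+ d)) ?lerDl //.
    by rewrite ler_piMl // ge_min lexx orbT.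
  - exact: mu0.
  - exact: x_ge0.
  - exact: x_neq0.
  - by move=> i; rewrite tapply_addC (le_trans (mux i)) // lerDl mulr_ge0 ?exprn_ge0 ?sumr_ge0 // ltW.
  (* On the simplex the perturbation contributes exactly [s], so the eigenvalue equation of [A]
     fails by [s <= t]. *)
  have res i : tapply A y i - l * y i ^+ d = - s.
    by rewrite -yE tapply_addC y1 expr1n mulr1 opprD addrA subrr add0r.
  exists (env y l); first by apply: box_env; rewrite // (le_trans mu0).
  have Nt0 : - t <= 0 by rewrite oppr_le0 ltW.
  case=> [[i|i]|[[]|[]]] /=; rewrite ?sum_env ?y1 ?subrr //.
  - by rewrite tapply_env nth_env_last nth_env res lerN2 ge_min lexx.
  - rewrite tapply_env nth_env_last nth_env res opprK.
    by rewrite (le_trans Nt0) // ltW.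
  - by rewrite nth_env_last (le_trans Nt0) // subr_ge0.
pose y (i : 'I_n) := e`_i; exists y, e`_n.
split.
- by move=> i; have /andP[] := be (widen_ord (leqnSn n) i).
- apply: simplex_neq0; apply/le_anti; rewrite -subr_ge0 -[X in _ && X]subr_ge0.
  by rewrite (ge (inr (inl false))) (ge (inr (inl true))).
- by rewrite -subr_ge0; exact: (ge (inr (inr tt))).
- move=> i; apply/le_anti; rewrite -subr_ge0 -[X in _ && X]subr_ge0.
  have := ge (inl (inr i)); rewrite /= opprB => ->.
  exact: (ge (inl (inl i))).
Qed.

End TensorAction.

(** * Powers of a tensor and complex eigenvalues *)

Lemma tprod_ge0 (R : rcfType) n a b (A : tensor R n a) (B : tensor R n b) :
  nonneg_tensor A -> nonneg_tensor B -> nonneg_tensor (tprod A B).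
Proof.
by move=> A0 B0 i al; apply: sumr_ge0 => j _; rewrite mulr_ge0 ?prodr_ge0.
Qed.

Lemma tpowS_ge0 (R : rcfType) n a (A : tensor R n a) k :
  nonneg_tensor A -> nonneg_tensor (tpowS A k).
Proof. by move=> A0; elim: k => //= k; exact: tprod_ge0. Qed.

Lemma rowsumE (R : rcfType) n a (A : tensor R n a) i :
  nonneg_tensor A -> rowsum A i = \sum_al A i al.
Proof. by move=> A0; apply: eq_bigr => al _; rewrite ger0_norm. Qed.

Lemma blk_inj a b (t t' : 'I_a) (s s' : 'I_b) :
  blk t s = blk t' s' -> t = t' /\ s = s'.
Proof.
move=> /(congr1 val) /= ts; have b0 : (0 < b)%N := leq_ltn_trans (leq0n s) (ltn_ord s).
split; apply: val_inj => /=.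
  by have := congr1 (divn^~ b) ts; rewrite !divnMDl // !divn_small ?addn0.
by have := congr1 (modn^~ b) ts; rewrite !modnMDl !modn_small.
Qed.

(* Splitting the index tuple into blocks is a bijection, so the row sums of a
   product factor. *)
Lemma rowsum_tprod (R : rcfType) n a b (A : tensor R n a) (B : tensor R n b) i :
  nonneg_tensor A -> nonneg_tensor B ->
  rowsum (tprod A B) i = tapply A (rowsum B) i.
Proof.
move=> A0 B0; rewrite rowsumE; last exact: tprod_ge0.
rewrite exchange_big /=; apply: eq_bigr => j _.
rewrite -mulr_sumr; congr (_ * _).
under [RHS]eq_bigr do rewrite rowsumE //.
rewrite bigA_distr_bigA /=.
pose split (al : {ffun 'I_(a * b) -> 'I_n}) : {ffun 'I_a -> {ffun 'I_b -> 'I_n}} :=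
  [ffun t => [ffun s => al (blk t s)]].
have blk_bij : bijective (fun ts : 'I_a * 'I_b => blk ts.1 ts.2).
  apply: inj_card_bij; last by rewrite card_prod !card_ord.
  by move=> [t s] [t' s'] /blk_inj[/= -> ->].
have split_bij : bijective split.
  apply: inj_card_bij.
    move=> al al' eq_al; apply/ffunP => u.
    have [g _ gK] := blk_bij; rewrite -(gK u).
    by have /ffunP/(_ (g u).1)/ffunP/(_ (g u).2) := eq_al; rewrite !ffunE.
  by rewrite !card_ffun !card_ord mulnC expnM.
rewrite [RHS](reindex split) /=; last exact: onW_bij.
by apply: eq_bigr => al _; apply: eq_bigr => t _; rewrite ffunE.
Qed.

(** A vanishing sum of nonnegative terms with positive monomials would force row [i] of [A] to be
    zero. *)
Lemma tapply_gt0 (R : rcfType) n d (A : tensor R n d) (x : 'I_n -> R) i :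
  nonneg_tensor A -> rowsum A i != 0 -> (forall j, 0 < x j) -> 0 < tapply A x i.
Proof.
move=> A0 rA x0; have Ax : 0 <= tapply A x i by apply: tapply_ge0 => // j; exact: ltW.
rewrite lt_neqAle Ax andbT eq_sym; apply: contra rA.
rewrite psumr_eq0 => [/allP Az|j _]; last by rewrite mulr_ge0 ?prodr_ge0 // => t _; exact: ltW.
rewrite rowsumE //; apply/eqP; apply: big1 => j _.
have := Az j (mem_index_enum j); rewrite mulf_eq0 => /orP[/eqP//|].
by rewrite gt_eqF // prodr_gt0.
Qed.

Lemma rowsum_tpowS_gt0 (R : rcfType) n a (A : tensor R n a) k i :
  nonneg_tensor A -> (forall i, rowsum A i != 0) -> 0 < rowsum (tpowS A k) i.
Proof.
move=> A0 rA; elim: k i => [|k IH] i /=.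
  by rewrite lt_neqAle eq_sym rA sumr_ge0.
by rewrite rowsum_tprod ?tapply_gt0 //; exact: tpowS_ge0.
Qed.

(** * Passage between complex eigenvalues and real nonnegative vectors *)

Lemma eigenvalue_real (R : rcfType) n m (A : tensor R n m.-1) (x : 'I_n -> R) l :
  (exists i, x i != 0) -> (forall i, tapply A x i = l * x i ^+ m.-1) ->
  Defs.eigenvalue A l%:C%C.
Proof.
move=> [i0 xi0] Ax; exists (fun i => (x i)%:C%C); split.
  by exists i0; rewrite fmorph_eq0.
move=> i; rewrite -rmorphXn -rmorphM /= -Ax rmorph_sum /=; apply: eq_bigr => j _.
by rewrite rmorphM rmorph_prod.
Qed.

(** Take moduli in the eigenvalue equation and apply the triangle inequality. *)
Lemma eigenvalue_abs (R : rcfType) n m (A : tensor R n m.-1) l :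
  nonneg_tensor A -> Defs.eigenvalue A l ->
  exists y : 'I_n -> R, [/\ (forall i, 0 <= y i), (exists i, y i != 0)
    & forall i, ComplexField.Normc.normc l * y i ^+ m.-1 <= tapply A y i].
Proof.
move=> A0 [x [[i0 xi0] Ax]].
pose nc := @ComplexField.Normc.normc R.
(* [normc] takes values in [R], the generic norm in [R[i]]; the inequalities are transported to
   [R[i]]. *)
have ncE z : ((nc z)%:C)%C = `|z| by case: z.
exists (fun i => nc (x i)); split.
- by move=> i; rewrite -ler0c ncE.
- by exists i0; rewrite -(fmorph_eq0 (real_complex R)) /= ncE normr_eq0.
move=> i; rewrite -lecR rmorphM rmorphXn /= !ncE -normrX -normrM -Ax.
apply: le_trans (ler_norm_sum _ _ _) _; rewrite rmorph_sum /= ler_sum // => j _.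
rewrite rmorphM rmorph_prod normrM normr_prod /=.
rewrite ger0_norm ?ler0c ?A0 //; by under [X in _ <= _ * X]eq_bigr do rewrite ncE.
Qed.

Theorem theorem3p4 (R : rcfType) (m n k : nat) (hm : (2 <= m)%N) (hn : (1 <= n)%N)
  (hk : (1 <= k)%N) (A : tensor R n m.-1) (hA : nonneg_tensor A)
  (hr : forall i : 'I_n, rowsum A i != 0) (rho : R)
  (hrho : is_spectral_radius A rho) :
  let ratio := fun i : 'I_n =>
    rowsum (tpowS A k) i / (rowsum (tpowS A k.-1) i) ^+ m.-1 in
  \big[Num.min/ratio (Ordinal hn)]_(i < n) ratio i <= rho /\
  rho <= \big[Num.max/ratio (Ordinal hn)]_(i < n) ratio i.
Proof.
(* The exponent of the theorem is now [k.+1], and [tpowS A k] is that power, so [x] is the vector of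
   row sums in the denominators. *)
case: k hk => // {}k _ ratio; set x := rowsum (tpowS A k).
have x0 i : 0 < x i by exact: rowsum_tpowS_gt0.
have ratioE i : tapply A x i = ratio i * x i ^+ m.-1.
  rewrite /ratio divfK ?expf_neq0 ?gt_eqF //= rowsum_tprod //.
  exact: tpowS_ge0.
have d0 : (0 < m.-1)%N by rewrite -subn1 subn_gt0.
have [[l0 [/(eigenvalue_abs hA)[y [y0 [i yi] ly]] <-]] rho_max] := hrho.
split; last first.
  apply: (collatz_wielandt_le hA x0 y0 yi ly) => j.
  by rewrite ratioE ler_wpM2r ?exprn_ge0 ?(ltW (x0 j)) // le_bigmax.
set mu := \big[_/_]_(_ < _) _.
have mu0 : 0 <= mu.
  by apply: le_bigmin => *; rewrite divr_ge0 ?exprn_ge0 ?sumr_ge0.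
have [||| z [l [z0 zn0 mul zE]]] := @perron_nonneg _ _ _ A x mu d0 hA mu0.
- by move=> j; exact: ltW.
- by exists (Ordinal hn); rewrite gt_eqF.
- by move=> j; rewrite ratioE ler_wpM2r ?exprn_ge0 ?(ltW (x0 j)) // bigmin_le.
apply: le_trans mul _.
apply: le_trans (rho_max _ (eigenvalue_real zn0 zE)).
(* The modulus of the real eigenvalue [l] is the square root of its square, hence at least [l]. *)
by rewrite /= expr0n addr0 sqrtr_sqr ler_norm.
Qed.
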